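(* Let $m$ be a topological partial action of a topological group $G$ on a topological space $\mathbb{X}$. Then the enveloping space $\mathbb{X}_G$ is the quotient space of $G\times\mathbb{X}$ by the equivalence relation $\widehat{E}^p_G$.
   Context: A partial action of a group $G$ (identity $1$) on a set $\mathbb{X}$ is a partially defined function $m$ from $G\times\mathbb{X}$ to $\mathbb{X}$, written $(g,x)\mapsto g\cdot x$, such that for all $g,h\in G$, $x\in\mathbb{X}$: (PA1) if $g\cdot x$ is defined then $g^{-1}\cdot(g\cdot x)$ is defined and equals $x$; (PA2) if $g\cdot(h\cdot x)$ is defined then $(gh)\cdot x$ is defined and $g\cdot(h\cdot x)=(gh)\cdot x$; (PA3) $1\cdot x$ is defined and equals $x$. Put $\mathbb{X}_{g^{-1}}=\{x\in\mathbb{X}: g\cdot x\text{ is defined}\}$, and let $m_g:\mathbb{X}_{g^{-1}}\to\mathbb{X}_g$, $x\mapsto g\cdot x$ (a bijection). The partial action is topological if each $\mathbb{X}_g$ is open in $\mathbb{X}$ and each $m_g$ is a homeomorphism. The enveloping space $\mathbb{X}_G$ is the quotient space $(G\times\mathbb{X})/R$ (with the quotient topology from the product $G\times\mathbb{X}$), where $(g,x)R(h,y)$ iff $x\in\mathbb{X}_{g^{-1}h}$ and $m_{h^{-1}g}(x)=y$. The partial action $\hat m$ of $G$ on $G\times\mathbb{X}$ associated to $m$ is: $g\cdot(h,x)$ is defined iff $x\in\mathbb{X}_{g^{-1}}$, and then $g\cdot(h,x)=(hg^{-1},g\cdot x)$. $\widehat{E}^p_G$ is the orbit equivalence relation of $\hat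 m$ on $G\times\mathbb{X}$: $(h,x)\,\widehat{E}^p_G\,(k,y)$ iff there is $g\in G$ such that $g\cdot(h,x)$ is defined and equals $(k,y)$. *)

(* Defs.v *)
From HB Require Import structures.
From mathcomp Require Import all_boot.
From mathcomp Require Import all_classical topology.

Set Implicit Arguments.
Unset Strict Implicit.
Unset Printing Implicit Defensive.

Local Open Scope classical_set_scope.
Local Open Scope quotient_scope.
Local Open Scope group_scope.

HB.mixin Record Group_Topological_isTopologicalGroup G
    of Group G & Topological G := {
  mulg_continuous : continuous (fun z : G * G => z.1 * z.2 : G);
  invg_continuous : continuous (fun x : G => x^-1)
}.

#[short(type="topologicalGroupType")]
HB.structure Definition TopologicalGroup :=
  {G of Group_Topological_isTopologicalGroup G & Group G & Topological G}.

(* [m g x = Some y] reads "g . x is defined and equals y"; [m g x = None]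
   reads "g . x is undefined". *)
Record partial_action (G : groupType) (X : Type) := PartialAction {
  pact :> G -> X -> option X;
  pactV : forall g x y, pact g x = Some y -> pact g^-1 y = Some x;
  pactM : forall g h x y z,
    pact h x = Some y -> pact g y = Some z -> pact (g * h) x = Some z;
  pact1 : forall x, pact 1 x = Some x
}.

(* The set X_g, so that X_{g^-1} is the set of the x with g . x defined. *)
Definition pact_dom (G : groupType) (X : Type) (m : partial_action G X)
  (g : G) : set X := [set x | m g^-1 x].

(* The map m_g : X_{g^-1} -> X_g, extended by the identity outside X_{g^-1}. *)
Definition pact_fun (G : groupType) (X : Type) (m : partial_action G X)
  (g : G) (x : X) : X := odflt x (m g x).

(* [f] restricts to a homeomorphism from [A] onto [B], both with the subspace
   topology; values outside [A] and [B] are irrelevant. *)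
Definition homeomorphism_on (X : topologicalType) (A B : set X) (f : X -> X) :=
  [/\ set_bij A B f, {within A, continuous f} &
      exists f' : X -> X,
        {in A, cancel f f'} /\ {within B, continuous f'}].

(* Joint continuity of the partial action is not required. *)
Definition topological_partial_action (G : groupType) (X : topologicalType)
    (m : partial_action G X) : Prop :=
  (forall g, open (pact_dom m g)) /\
  (forall g, homeomorphism_on (pact_dom m g^-1) (pact_dom m g) (pact_fun m g)).

Section OrbitEquivalence.
Variables (G : groupType) (X : Type) (a : partial_action G X).

Definition orbit_rel (x y : X) : Prop := exists g, a g x = Some y.

Let orbit_relb : rel X := fun x y => `[< orbit_rel x y >].

Let orbit_refl : reflexive orbit_relb.
Proof. by move=> x; apply/asboolP; exists 1; exact: pact1. Qed.

Let orbit_sym : symmetric orbit_relb.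
Proof.
suff H x y : orbit_rel x y -> orbit_rel y x.
  by move=> x y; apply/asboolP/asboolP; exact: H.
by case=> g gxy; exists g^-1; apply: pactV gxy.
Qed.

Let orbit_trans : transitive orbit_relb.
Proof.
move=> y x z /asboolP[h hxy] /asboolP[g gyz]; apply/asboolP.
by exists (g * h); apply: pactM hxy gyz.
Qed.

Definition orbit_equiv : equiv_rel X :=
  EquivRel orbit_relb orbit_refl orbit_sym orbit_trans.

End OrbitEquivalence.

Section ProductAction.
Variables (G : groupType) (X : Type) (m : partial_action G X).

Definition prod_pact (g : G) (u : G * X) : option (G * X) :=
  omap (fun y => (u.1 * g^-1, y)) (m g u.2).

Let prod_pactV g u v : prod_pact g u = Some v -> prod_pact g^-1 v = Some u.
Proof.
case: u v => h x [k y]; rewrite /prod_pact /=.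
case E: (m g x) => [z|]//= -[<- <-].
by rewrite (pactV E)/= invgK mulgVK.
Qed.

Let prod_pactM g h u v w :
  prod_pact h u = Some v -> prod_pact g v = Some w ->
  prod_pact (g * h) u = Some w.
Proof.
case: u v w => k x [l y] [n z]; rewrite /prod_pact /=.
case E: (m h x) => [y'|]//= -[<- <-].
case F: (m g y') => [z'|]//= -[<- <-].
by rewrite (pactM E F)/= invgM mulgA.
Qed.

Let prod_pact1 u : prod_pact 1 u = Some u.
Proof. by case: u => h x; rewrite /prod_pact /= pact1/= invg1 mulg1. Qed.

Definition prod_action : partial_action G (G * X)%type :=
  PartialAction prod_pactV prod_pactM prod_pact1.

End ProductAction.

Section EnvelopingRelation.
Variables (G : groupType) (X : Type) (m : partial_action G X).

Definition enveloping_rel (u v : G * X) : Prop :=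
  let: (g, x) := u in let: (h, y) := v in
  pact_dom m (g^-1 * h) x /\ pact_fun m (h^-1 * g) x = y.

Lemma enveloping_relE g x h y :
  enveloping_rel (g, x) (h, y) <-> m (h^-1 * g) x = Some y.
Proof.
rewrite /enveloping_rel /pact_dom /pact_fun /= invgM invgK.
by case: (m _ x) => [z|] /=; split=> -[] // _ ->.
Qed.

Let enveloping_relb : rel (G * X)%type := fun u v => `[< enveloping_rel u v >].

Let enveloping_refl : reflexive enveloping_relb.
Proof.
by case=> g x; apply/asboolP/enveloping_relE; rewrite mulVg pact1.
Qed.

Let enveloping_sym : symmetric enveloping_relb.
Proof.
suff H u v : enveloping_rel u v -> enveloping_rel v u.
  by move=> u v; apply/asboolP/asboolP; exact: H.
case: u v => [g x] [h y] /enveloping_relE E; apply/enveloping_relE.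
by have := pactV E; rewrite invgM invgK.
Qed.

Let enveloping_trans : transitive enveloping_relb.
Proof.
move=> [h y] [g x] [k z] /asboolP/enveloping_relE xy.
move/asboolP/enveloping_relE => yz; apply/asboolP/enveloping_relE.
by have := pactM xy yz; rewrite -mulgA mulVKg.
Qed.

Definition enveloping_equiv : equiv_rel (G * X)%type :=
  EquivRel enveloping_relb enveloping_refl enveloping_sym enveloping_trans.

End EnvelopingRelation.

(* A space together with a map onto it from [T]: equality of two such records
   identifies the spaces compatibly with their projections from [T]. *)
Record space_under (T : topologicalType) := SpaceUnder {
  space_carrier :> topologicalType;
  space_proj : T -> space_carrier
}.

Definition quotient_space (T : topologicalType) (e : equiv_rel T) :
    space_under T :=
  @SpaceUnder T (quotient_topology {eq_quot e}) \pi_(quotient_topology {eq_quot e}).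

Definition enveloping_space (G : topologicalGroupType) (X : topologicalType)
    (m : partial_action G X) : space_under (G * X)%type :=
  quotient_space (enveloping_equiv m).

(* Main.v *)
(* If [g . (h, x)] is defined and equals [(k, y)] then [k = h g^-1], which
   forces [g = k^-1 h]: the orbit relation of the product action is the
   enveloping relation itself, hence the two quotients coincide. *)
Require Import Defs.
From HB Require Import structures.
From mathcomp Require Import all_boot.
From mathcomp Require Import all_classical topology.

Local Open Scope group_scope.

(** An [equiv_rel] bundles a boolean relation with a proof of its laws: function extensionality
    identifies the relations, proof irrelevance the proofs. *)
Lemma equiv_rel_ext (T : Type) (e f : equiv_rel T) :
  (forall x y, e x y = f x y) -> e = f.
Proof.
case: e f => [e ce] [f cf] /= ef.
have {}ef : e = f by apply/funext => x; apply/funext => y; exact: ef.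
by case: _ / ef cf => cf; rewrite (Prop_irrelevance ce cf).
Qed.

Lemma orbit_prod_action_enveloping (G : groupType) (X : Type)
    (m : partial_action G X) (u v : G * X) :
  orbit_rel (prod_action m) u v <-> enveloping_rel m u v.
Proof.
case: u v => [h x] [k y]; rewrite enveloping_relE; split=> [[g]|mxy].
  rewrite /= /prod_pact /=; case E: (m g x) => [z|]//= -[<- <-].
  (* Here [k] has become [h * g^-1], so [k^-1 * h] reduces to [g] and [E] closes the goal. *)
  by rewrite invgM invgK mulgVK.
by exists (k^-1 * h); rewrite /= /prod_pact /= mxy /= invgM invgK mulVKg.
Qed.

(** Equality of the bundled relations, not mere equivalence, lets one rewrite carry over the
    quotient type, its topology and its projection together. *)
Lemma enveloping_equivE (G : groupType) (X : Type) (m : partial_action G X) :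
  enveloping_equiv m = orbit_equiv (prod_action m).
Proof.
apply: equiv_rel_ext => u v.
by apply/asboolP/asboolP => /orbit_prod_action_enveloping.
Qed.

Theorem theorem3p3 (G : topologicalGroupType) (X : topologicalType)
    (m : partial_action G X) (hm : topological_partial_action m) :
  enveloping_space m = quotient_space (orbit_equiv (prod_action m)).
Proof. by rewrite /enveloping_space enveloping_equivE. Qed.
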